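(* Let $\mu=\mu_1\otimes\dots\otimes\mu_d$ be a product probability measure on $\mathbb{R}^d$ whose marginals $\mu_i$ admit a second moment. Let $f,g:\mathbb{R}^d\to\mathbb{R}$ be functions in $L^2(\mu)$ all of whose first and second partial derivatives are integrable with respect to $\mu$. Assume that for each couple $1\le i,j\le d$, the signs of $\partial_{i,j}f(x)$ and $\partial_{i,j}g(x)$ are constant on $\mathbb{R}^d$ and equal. Then $$\mathrm{Cov}_\mu(f,g)\ \ge\ \sum_{i=1}^d\frac{1}{\mathrm{Var}(\mu_i)}\,\mathrm{Cov}_\mu(f(x),x_i)\,\mathrm{Cov}_\mu(g(x),x_i).$$
   Context: $\mathrm{Cov}_\mu(f,g)=\int (f-\int f\,d\mu)(g-\int g\,d\mu)\,d\mu$; $\mathrm{Var}(\mu_i)$ is the variance of $\mu_i$; $x_i$ denotes the $i$-th coordinate function. ''The signs of $u$ and $v$ are constant and equal'' means: either $u\ge0$ and $v\ge0$ everywhere, or $u\le0$ and $v\le0$ everywhere; the common sign may depend on $(i,j)$. Standing convention: all functions have enough integrability and regularity for all written quantities to be well defined (in particular $\mathrm{Var}(\mu_i)>0$). *)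

(* Defs.v *)
From HB Require Import structures.
From mathcomp Require Import all_boot all_order all_algebra.
From mathcomp Require Import all_classical all_reals all_analysis.
Set Implicit Arguments.
Unset Strict Implicit.
Unset Printing Implicit Defensive.
Import Order.TTheory GRing.Theory Num.Theory.
Import numFieldNormedType.Exports.
Local Open Scope classical_set_scope.
Local Open Scope ring_scope.

Definition measure_rV_display : measure_display.
Proof. exact: default_measure_display. Qed.

(* The product sigma-algebra on R^n, i.e. the one generated by the coordinates
   (R carries its Borel sigma-algebra). *)
Section measurable_rV.
Context {R : realType}.
Variable n : nat.

Let coors : 'I_n -> 'rV[R]_n -> measurableTypeR R := fun i x => x ord0 i.

Let rV_set0 : g_sigma_preimage coors set0.
Proof. exact: sigma_algebra0. Qed.

Let rV_setC A : g_sigma_preimage coors A -> g_sigma_preimage coors (~` A).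
Proof. exact: sigma_algebraC. Qed.

Let rV_bigcup (F : (set 'rV[R]_n)^nat) :
  (forall i, g_sigma_preimage coors (F i)) ->
  g_sigma_preimage coors (\bigcup_i (F i)).
Proof. exact: sigma_algebra_bigcup. Qed.

HB.instance Definition _ :=
  @isMeasurable.Build measure_rV_display
  'rV[R]_n (g_sigma_preimage coors) rV_set0 rV_setC rV_bigcup.

End measurable_rV.

Section definitions.
Context {R : realType} {d : nat}.

(* mu = mu_1 \otimes ... \otimes mu_d, by its values on measurable boxes. *)
Definition is_product_measure
    (mu : probability 'rV[R]_d R)
    (mui : 'I_d -> probability (measurableTypeR R) R) :=
  forall A : 'I_d -> set (measurableTypeR R), (forall i, measurable (A i)) ->
    mu [set x | forall i, A i (x ord0 i)] = (\prod_(i < d) mui i (A i))%E.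

Definition partial (i : 'I_d) (f : 'rV[R]_d -> R) : 'rV[R]_d -> R :=
  'D_(delta_mx ord0 i) f.

Definition has_partial (i : 'I_d) (f : 'rV[R]_d -> R) :=
  forall x, derivable f x (delta_mx ord0 i).

Definition coordinate (i : 'I_d) (x : 'rV[R]_d) : R := x ord0 i.

Definition same_constant_sign (u v : 'rV[R]_d -> R) :=
  ((forall x, 0 <= u x) /\ (forall x, 0 <= v x)) \/
  ((forall x, u x <= 0) /\ (forall x, v x <= 0)).

End definitions.

(* Main.v *)
From HB Require Import structures.
Require Import Defs.
From mathcomp Require Import all_boot all_order all_algebra.
From mathcomp Require Import all_classical all_reals all_analysis.
From mathcomp Require Import measurable_realfun ring lra.
Import Order.TTheory GRing.Theory Num.Theory.
Import numFieldNormedType.Exports.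
Local Open Scope classical_set_scope.
Local Open Scope ring_scope.

(** Let X0, X1, X2, X3 be independent random vectors of law mu. Since mu is a
    product, the joint law of the four vectors does not change when, in each
    coordinate separately, the four entries are permuted
    ([four_copies_rearrange]). Hence an expectation is nonnegative as soon as
    the sum of its integrand over some finite list of such permutations is
    pointwise nonnegative ([Ex_ge0_symmetrize]). The two inequalities below are
    obtained in this way.

    Write h_m for the vector whose entries of index less than m come from X1
    and whose other entries come from X0. Then
      Cov(f, g) = E[f(X0) (g(X0) - g(X1))] = sum_i T_i,
    with T_i = E[f(X0) (g(h_i) - g(h_{i+1}))], and it is enough to bound each
    T_i. Put C(u) = E[f(X0) g(u) (X0_i - X2_i) (X1_i - X3_i)].

    Diagonal step: Var(mu_i) T_i >= C(h_{i+1}) ([diagonal_step]). With the other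
    coordinates frozen this is the one-dimensional case of the theorem, a Gram
    determinant identity: after permuting the four i-th entries in all possible
    ways, the difference of the two sides becomes a sum, over the triples of
    copies, of products of the determinants with columns (1, x, f) and
    (1, x, g). Such a determinant is a Vandermonde determinant times a second
    divided difference, so the two factors have the same sign
    ([chord_det_same_sign]).

    Mixed step: for m > i, replacing the m-th entry of h_m by that of X1 does
    not increase C ([mixed_step]). After permuting entries in the columns i and
    m, the difference is the product of a mixed second difference of f and one
    of g, each multiplied by the i-th increment, and these agree in sign
    ([mixed_diff_same_sign]).

    Iterating the mixed step gives C(h_{i+1}) >= C(X1), and C(X1) is equal to
    Cov(f, x_i) Cov(g, x_i) by independence ([cross_prefix_last]). *)

(** * Signs of second differences *)

Section Differences.
Context {R : realType} {d : nat}.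
Implicit Types (f g : 'rV[R]_d -> R) (i j : 'I_d) (v : 'rV[R]_d).

Definition set_coord i (a : R) v : 'rV[R]_d :=
  \row_k (if k == i then a else v ord0 k).

Lemma set_coordC i j a b v : i != j ->
  set_coord i a (set_coord j b v) = set_coord j b (set_coord i a v).
Proof.
move=> ij; apply/rowP => k; rewrite !mxE.
by have [->|//] := eqVneq k i; rewrite (negbTE ij).
Qed.

Lemma is_derive_set_coord f i v (a : R) : has_partial i f ->
  is_derive a 1 (fun t : R => f (set_coord i t v))
    (partial i f (set_coord i a v)).
Proof.
move=> fi.
have E : (fun h : R => h^-1 *: (((fun t : R => f (set_coord i t v)) \o shift a) (h *: 1)
       - f (set_coord i a v)))
   = (fun h : R => h^-1 *: ((f \o shift (set_coord i a v)) (h *: delta_mx ord0 i)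
       - f (set_coord i a v))).
  apply/funext => h /=; congr (_ *: (f _ - _)).
  apply/rowP => k; rewrite !mxE eqxx /=.
  by case: (k == i) => /=; rewrite /GRing.scale /=; ring.
have D := fi (set_coord i a v).
split; first by rewrite /derivable E; exact: D.
by rewrite /derive E.
Qed.

(** The endpoints are not assumed to be ordered, so that the formula applies to
    arbitrary sample points. *)
Lemma mean_value (h h' : R -> R) (a b : R) :
  (forall x : R, is_derive x 1 h (h' x)) ->
  exists2 c, Order.min a b <= c <= Order.max a b & h b - h a = h' c * (b - a).
Proof.
move=> hh.
have hc : continuous h.
  by move=> x; apply: differentiable_continuous; apply/derivable1_diffP;
     have [] := hh x.
have [ab|ba] := leP a b.
  have [c] := MVT_segment ab (fun x _ => hh x) (continuous_subspaceT hc).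
  by rewrite in_itv /= => cab e; exists c.
have [c] := MVT_segment (ltW ba) (fun x _ => hh x) (continuous_subspaceT hc).
rewrite in_itv /= => cab e; exists c => //.
by rewrite -opprB e; ring.
Qed.

Lemma partial_mean_value f i v (a b : R) : has_partial i f ->
  exists2 c, Order.min a b <= c <= Order.max a b &
    f (set_coord i b v) - f (set_coord i a v) =
    partial i f (set_coord i c v) * (b - a).
Proof.
move=> fi; apply: (mean_value (fun t => f (set_coord i t v))
  (fun t => partial i f (set_coord i t v))).
by move=> x; exact: is_derive_set_coord.
Qed.

Definition mixed_diff f i j v (a a' b b' : R) : R :=
  (f (set_coord i a (set_coord j b v)) - f (set_coord i a' (set_coord j b v)))
  - (f (set_coord i a (set_coord j b' v)) - f (set_coord i a' (set_coord j b' v))).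

(** Apply the mean value theorem in direction i to the difference of two
    restrictions of f, and then in direction j to the partial derivative. *)
Lemma mixed_diff_mean_value f i j v (a a' b b' : R) : i != j ->
  has_partial i f -> has_partial j (partial i f) ->
  exists x, mixed_diff f i j v a a' b b' =
    partial j (partial i f) x * ((a - a') * (b - b')).
Proof.
move=> ij fi fij.
have [c _] := mean_value
  (fun t => f (set_coord i t (set_coord j b v)) - f (set_coord i t (set_coord j b' v)))
  (fun t => partial i f (set_coord i t (set_coord j b v))
            - partial i f (set_coord i t (set_coord j b' v))) a' a
  (fun x => @is_deriveB _ _ _ _ _ _ _ _ _
    (is_derive_set_coord f i _ x fi) (is_derive_set_coord f i _ x fi)).
rewrite !(set_coordC i j c) // => E.
have [e _ E'] := partial_mean_value (partial i f) j (set_coord i c v) b' b fij.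
exists (set_coord j e (set_coord i c v)).
by rewrite /mixed_diff [in RHS](mulrC (a - a')) mulrA -E' -E; ring.
Qed.

(** The same increment b - b' occurs for f and g, so it enters the product
    through its square, as do the other two increments. *)
Lemma mixed_diff_same_sign f g i j v v' (a a' b b' c c' : R) : i != j ->
  has_partial i f -> has_partial i g ->
  has_partial j (partial i f) -> has_partial j (partial i g) ->
  same_constant_sign (partial j (partial i f)) (partial j (partial i g)) ->
  0 <= (mixed_diff f i j v a a' b b' * (a - a')) *
       (mixed_diff g i j v' c c' b b' * (c - c')).
Proof.
move=> ij fi gi fij gij s.
have [x ->] := mixed_diff_mean_value f i j v a a' b b' ij fi fij.
have [y ->] := mixed_diff_mean_value g i j v' c c' b b' ij gi gij.
have pq : 0 <= partial j (partial i f) x * partial j (partial i g) y.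
  by case: s => -[sf sg]; [apply: mulr_ge0|apply: mulr_le0].
move: (partial j _ x) (partial j _ y) pq => p q pq.
have -> : p * ((a - a') * (b - b')) * (a - a') *
    (q * ((c - c') * (b - b')) * (c - c')) =
  p * q * ((a - a') * (c - c') * (b - b')) ^+ 2 by ring.
by apply: mulr_ge0 => //; exact: sqr_ge0.
Qed.

(** Up to sign, the determinant with rows (1, t, F t) for t = x, y, z; it measures
    the position of a point of the graph of F with respect to a chord. *)
Definition chord_det (F : R -> R) (x y z : R) : R :=
  F x * (y - z) + F y * (z - x) + F z * (x - y).

(** For ordered points the determinant is (y - x) (z - y) times the difference
    of the slopes of two consecutive chords; the slopes are values of the first
    derivative at ordered points, whence the second derivative. *)
Lemma chord_det_sorted f i v (x y z : R) : x <= y -> y <= z ->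
  has_partial i f -> has_partial i (partial i f) ->
  exists2 K, 0 <= K & exists p,
  chord_det (fun t => f (set_coord i t v)) x y z = - K * partial i (partial i f) p.
Proof.
move=> xy yz fi fii.
have [c] := partial_mean_value f i v x y fi.
rewrite (min_idPl xy) (max_idPr xy) => /andP[xc cy] E1.
have [c'] := partial_mean_value f i v y z fi.
rewrite (min_idPl yz) (max_idPr yz) => /andP[yc' c'z] E2.
have [e _ E3] := partial_mean_value (partial i f) i v c c' fii.
exists ((y - x) * (z - y) * (c' - c)).
  by apply: mulr_ge0; [apply: mulr_ge0|]; lra.
exists (set_coord i e v); rewrite /chord_det.
rewrite -mulNr -[RHS]mulrA -mulNr.
have -> : (c' - c) * partial i (partial i f) (set_coord i e v) =
  partial i f (set_coord i c' v) - partial i f (set_coord i c v) by rewrite E3 mulrC.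
set fx := f (set_coord i x v); set fy := f (set_coord i y v); set fz := f (set_coord i z v).
have -> : fx * (y - z) + fy * (z - x) + fz * (x - y) =
  (fy - fx) * (z - y) - (fz - fy) * (y - x) by ring.
rewrite E1 E2; ring.
Qed.

(** Both determinants change sign when two of the points are exchanged, so the
    product may be computed for ordered points. *)
Lemma chord_det_same_sign f g i v v' (x y z : R) :
  has_partial i f -> has_partial i g ->
  has_partial i (partial i f) -> has_partial i (partial i g) ->
  same_constant_sign (partial i (partial i f)) (partial i (partial i g)) ->
  0 <= chord_det (fun t => f (set_coord i t v)) x y z *
       chord_det (fun t => g (set_coord i t v')) x y z.
Proof.
move=> fi gi fii gii s.
set F := (fun t => f _); set G := (fun t => g _).
have sorted : forall x y z, x <= y -> y <= z -> 0 <= chord_det F x y z * chord_det G x y z.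
  move=> {}x {}y {}z xy yz.
  have [K K0 [p ->]] := chord_det_sorted f i v x y z xy yz fi fii.
  have [L L0 [q ->]] := chord_det_sorted g i v' x y z xy yz gi gii.
  rewrite mulrACA mulrNN; apply: mulr_ge0; first exact: mulr_ge0.
  by case: s => -[sf sg]; [apply: mulr_ge0|apply: mulr_le0].
have swap12 : forall x y z, chord_det F x y z * chord_det G x y z =
    chord_det F y x z * chord_det G y x z by move=> {}x {}y {}z; rewrite /chord_det; ring.
have swap23 : forall x y z, chord_det F x y z * chord_det G x y z =
    chord_det F x z y * chord_det G x z y by move=> {}x {}y {}z; rewrite /chord_det; ring.
wlog xy : x y / x <= y.
  by move=> H; have [/H//|/ltW/H] := leP x y; rewrite swap12.
have [yz|/ltW zy] := leP y z; first exact: sorted.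
have [xz|/ltW zx] := leP x z; first by rewrite swap23; exact: sorted.
by rewrite swap23 swap12; exact: sorted.
Qed.

End Differences.

(** * Real-valued expectations, image and product measures *)

Section Expectation.
Context {R : realType} {dT : measure_display} {T : measurableType dT}.
Variable P : probability T R.
Implicit Types h u v : T -> R.

Definition Ex h : R := (\int[P]_x h x)%R.

Lemma Lfun1P h : h \in Lfun P 1 -> P.-integrable setT (EFin \o h).
Proof. by move/Lfun1_integrable. Qed.

Lemma Lfun_measurable h (p : \bar R) : h \in Lfun P p -> measurable_fun setT h.
Proof. by move/(@sub_Lfun_mfun _ _ _ _ _ _); rewrite inE. Qed.

Lemma expectationEx h : h \in Lfun P 1 -> ('E_P[h] = (Ex h)%:E)%E.
Proof.
by move=> h1; rewrite unlock /Ex /Rintegral fineK// integrable_fin_num//; exact: Lfun1P.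
Qed.

Lemma ExD u v : u \in Lfun P 1 -> v \in Lfun P 1 ->
  Ex (fun x => u x + v x) = Ex u + Ex v.
Proof. by move=> /Lfun1P ? /Lfun1P ?; rewrite /Ex RintegralD. Qed.

Lemma ExB u v : u \in Lfun P 1 -> v \in Lfun P 1 ->
  Ex (fun x => u x - v x) = Ex u - Ex v.
Proof. by move=> /Lfun1P ? /Lfun1P ?; rewrite /Ex RintegralB. Qed.

Lemma Ex_ge0 h : (forall x, 0 <= h x) -> 0 <= Ex h.
Proof. by move=> h0; apply: Rintegral_ge0 => x _. Qed.

Lemma Ex_cst (c : R) : Ex (fun=> c) = c.
Proof. by rewrite /Ex Rintegral_cst//= [X in fine X]probability_setT mulr1. Qed.

Lemma Lfun1_cst (c : R) : (fun=> c) \in Lfun P 1.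
Proof. exact: Lfun_cst. Qed.

Lemma Lfun2_cst (c : R) : (fun=> c) \in Lfun P 2%:E.
Proof. exact: Lfun_cst. Qed.

Lemma eq_Lfun (p : \bar R) u v : u =1 v -> u \in Lfun P p -> v \in Lfun P p.
Proof. by move=> /funext ->. Qed.

Lemma Lfun_add (p : \bar R) u v : (1 <= p)%E ->
  u \in Lfun P p -> v \in Lfun P p -> (fun x => u x + v x) \in Lfun P p.
Proof. by move=> p1 up vp; exact: (Lfun_addr_closed P p1).2. Qed.

Lemma Lfun_sub (p : \bar R) u v : (1 <= p)%E ->
  u \in Lfun P p -> v \in Lfun P p -> (fun x => u x - v x) \in Lfun P p.
Proof.
move=> p1 up vp; apply: (Lfun_add p u (fun x => - v x)) => //.
exact: Lfun_oppr_closed.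
Qed.

Lemma Lfun_mul2 u v :
  u \in Lfun P 2%:E -> v \in Lfun P 2%:E -> (fun x => u x * v x) \in Lfun P 1.
Proof. exact: Lfun2_mul_Lfun1. Qed.

Lemma Lfun2_mulr u (c : R) : u \in Lfun P 2%:E -> (fun x => u x * c) \in Lfun P 2%:E.
Proof. by move=> u2; apply: Lfun_scale => //; rewrite ler1n. Qed.

Lemma Lfun21 u : u \in Lfun P 2%:E -> u \in Lfun P 1.
Proof. by apply: Lfun_subset12; exact: fin_num_measure. Qed.

Lemma Lfun2P u : measurable_fun setT u ->
  (u \in Lfun P 2%:E) = ((fun x => u x ^+ 2) \in Lfun P 1).
Proof.
move=> mu; apply/idP/idP => [/Lfun2_integrable_sqr ?|/Lfun1P/integrableP[_]].
  exact/Lfun1_integrable.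
move=> fin; rewrite inE; apply/andP; split; first by rewrite inE.
rewrite inE /finite_norm /= unlock poweR_lty//.
apply: le_lt_trans fin; rewrite le_eqVlt; apply/orP; left; apply/eqP.
by apply: eq_integral => x _ /=; rewrite powR_mulrn// normrX.
Qed.

End Expectation.

Section MeasurePreserving.
Context {R : realType} {d1 d2 : measure_display}
  {T1 : measurableType d1} {T2 : measurableType d2}.
Variables (P1 : probability T1 R) (P2 : probability T2 R) (phi : T1 -> T2).
Hypothesis mphi : measurable_fun setT phi.
Hypothesis phiP : forall A, measurable A -> P1 (phi @^-1` A) = P2 A.

(** The equivalence, rather than one implication, is what allows integrability
    to be descended from a product to one of its factors. *)
Lemma Lfun1_preservingE h : measurable_fun setT h ->
  (h \o phi \in Lfun P1 1) = (h \in Lfun P2 1).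
Proof.
move=> mh; have mEh : measurable_fun setT (EFin \o h) by exact/measurable_EFinP.
have E : (\int[P1]_x `|(EFin \o (h \o phi)) x| = \int[P2]_x `|(EFin \o h) x|)%E.
  rewrite [RHS](eq_measure_integral (pushforward P1 phi)); last first.
    by move=> A mA _; exact/esym/phiP.
  by rewrite ge0_integral_pushforward//; exact: measurableT_comp.
apply/idP/idP => /Lfun1P/integrableP[_ fin];
  apply/Lfun1_integrable/integrableP; split => //.
- by rewrite -E.
- by apply/measurable_EFinP/measurableT_comp.
- by rewrite E.
Qed.

Lemma Lfun1_preserving h : h \in Lfun P2 1 -> h \o phi \in Lfun P1 1.
Proof. by move=> h1; rewrite Lfun1_preservingE//; exact: Lfun_measurable h1. Qed.

Lemma Lfun2_preserving h : h \in Lfun P2 2%:E -> h \o phi \in Lfun P1 2%:E.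
Proof.
move=> h2; have mh := Lfun_measurable _ _ _ h2.
rewrite Lfun2P in h2 => //; rewrite Lfun2P; last exact: measurableT_comp.
exact: (Lfun1_preserving _ h2).
Qed.

Lemma Ex_preserving h : h \in Lfun P2 1 -> Ex P1 (h \o phi) = Ex P2 h.
Proof.
move=> h1; have /Lfun1P/integrableP[mh _] := h1.
have ih := Lfun1P _ _ (Lfun1_preserving _ h1).
rewrite /Ex /Rintegral; congr fine.
rewrite [RHS](eq_measure_integral (pushforward P1 phi)); last first.
  by move=> A mA _; exact/esym/phiP.
by rewrite integral_pushforward.
Qed.

End MeasurePreserving.

Section Product.
Context {R : realType} {d1 d2 : measure_display}
  {T1 : measurableType d1} {T2 : measurableType d2}.
Variables (P1 : probability T1 R) (P2 : probability T2 R).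
Local Notation P := ((P1 \x P2)%E : probability _ R).

Lemma Lfun1_prod u v : u \in Lfun P1 1 -> v \in Lfun P2 1 ->
  (fun z => u z.1 * v z.2) \in Lfun P 1.
Proof.
move=> u1 v1; apply/Lfun1_integrable.
have muv : measurable_fun setT (EFin \o (fun z : T1 * T2 => u z.1 * v z.2)).
  apply/measurable_EFinP/measurable_funM.
    exact: (measurableT_comp (Lfun_measurable _ _ _ u1)).
  exact: (measurableT_comp (Lfun_measurable _ _ _ v1)).
apply: (integrable12ltyP P1 P2 muv).2 => /=.
have /Lfun1P/integrableP[_ fu] := u1; have /Lfun1P/integrableP[_ fv] := v1.
have mau : measurable_fun setT (fun x => (`|u x|)%:E).
  by apply/measurable_EFinP/measurableT_comp => //; exact: Lfun_measurable u1.
have mav : measurable_fun setT (fun x => (`|v x|)%:E).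
  by apply/measurable_EFinP/measurableT_comp => //; exact: Lfun_measurable v1.
under eq_integral => x _.
  under eq_integral do rewrite normrM EFinM.
  rewrite ge0_integralZl//.
  over.
rewrite ge0_integralZr//; last exact: integral_ge0.
by rewrite lte_mul_pinfty ?integral_ge0// ge0_fin_numE ?integral_ge0.
Qed.

Lemma Ex_prod u v : u \in Lfun P1 1 -> v \in Lfun P2 1 ->
  Ex P (fun z => u z.1 * v z.2) = Ex P1 u * Ex P2 v.
Proof.
move=> u1 v1; have := Lfun1P _ _ (Lfun1_prod _ _ u1 v1).
move=> /integral12_prod_meas1 E; rewrite /Ex /Rintegral -E /=.
under eq_integral => x _.
  rewrite /fubini_F /=.
  under eq_integral do rewrite EFinM.
  rewrite integralZl//; last exact: Lfun1P.
  over.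
have vfin : (\int[P2]_x (v x)%:E)%E \is a fin_num by apply: integrable_fin_num => //; exact: Lfun1P.
rewrite -(fineK vfin) integralZr//; last exact: Lfun1P.
by rewrite fineM// integrable_fin_num//; exact: Lfun1P.
Qed.

Lemma Lfun2_prod u v : u \in Lfun P1 2%:E -> v \in Lfun P2 2%:E ->
  (fun z => u z.1 * v z.2) \in Lfun P 2%:E.
Proof.
move=> u2 v2; have mu := Lfun_measurable _ _ _ u2; have mv := Lfun_measurable _ _ _ v2.
rewrite Lfun2P; last first.
  by apply: measurable_funM;
    [exact: (measurableT_comp mu)|exact: (measurableT_comp mv)].
under eq_fun do rewrite exprMn.
by apply: (Lfun1_prod (fun x => u x ^+ 2) (fun x => v x ^+ 2)); rewrite -Lfun2P.
Qed.

End Product.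

(** * Measures determined by their values on boxes *)

Section Boxes.
Context {R : realType} {dT : measure_display} {T : measurableType dT}.
Variables (K : finType) (c : K -> T -> measurableTypeR R).

Definition box (A : K -> set (measurableTypeR R)) : set T :=
  [set x | forall k, A k (c k x)].

Hypothesis c_generate : forall B : set (set T), sigma_algebra setT B ->
  (forall k A, measurable A -> B (c k @^-1` A)) -> measurable `<=` B.
Hypothesis mc : forall k, measurable_fun setT (c k).

Lemma measurable_box A : (forall k, measurable (A k)) -> measurable (box A).
Proof.
move=> mA; have -> : box A = \bigcap_(k in [set: K]) (c k @^-1` (A k)).
  by apply/seteqP; split => x /= H k => [_|]; exact: H.
apply: fin_bigcap_measurable => // k _.
by rewrite -[X in measurable X]setTI; exact: mc.
Qed.

(** Boxes form a pi-system that generates the sigma-algebra. *)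
Lemma box_unique (m1 m2 : probability T R) :
  (forall A, (forall k, measurable (A k)) -> m1 (box A) = m2 (box A)) ->
  forall A, measurable A -> m1 A = m2 A.
Proof.
move=> m12 A mA.
pose G : set (set T) := [set B | exists2 A, forall k, measurable (A k) & B = box A].
have GT : G setT.
  exists (fun=> setT) => //.
  by apply/seteqP; split => x //.
apply: (measure_unique G (fun=> setT)) => //.
- apply/seteqP; split.
    apply: c_generate; first exact: smallest_sigma_algebra.
    move=> k B mB; apply: sub_sigma_algebra.
    exists (fun l => if l == k then B else setT).
      by move=> l; case: ifP.
    apply/seteqP; split => x /= H.
      by move=> l; case: eqP => [->|].
    by have := H k; rewrite eqxx.
  apply: smallest_sub; first exact: sigma_algebra_measurable.
  by move=> _ [B mB ->]; exact: measurable_box.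
- move=> _ _ [B mB ->] [C mC ->]; exists (fun k => B k `&` C k).
    by move=> k; exact: measurableI.
  apply/seteqP; split => x /=.
    by move=> [xB xC] k; split.
  by move=> xBC; split => k; have [] := xBC k.
- by apply/seteqP; split => // x _; exists 0%N.
- by move=> _ [B mB ->]; exact: m12.
- by move=> _; rewrite (le_lt_trans (probability_le1 _ _))// ltry.
Qed.

End Boxes.

Section RowVectors.
Context {R : realType} {d : nat}.

Lemma rV_generate (B : set (set 'rV[R]_d)) : sigma_algebra setT B ->
  (forall k (A : set (measurableTypeR R)), measurable A ->
     B (coordinate k @^-1` A)) -> measurable `<=` B.
Proof.
move=> sB cB; apply: smallest_sub => //.
by rewrite -bigcup_seq => _ [k _ [A mA <-]]; rewrite setTI; exact: cB.
Qed.

Lemma measurable_coordinate (k : 'I_d) :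
  measurable_fun setT (coordinate k : 'rV[R]_d -> measurableTypeR R).
Proof.
move=> _ A mA; rewrite setTI; apply: sub_sigma_algebra => /=.
rewrite -bigcup_seq/=; exists k => /=; first by rewrite mem_index_enum.
by exists A => //; rewrite setTI.
Qed.

Lemma measurable_fun_rV {dT : measure_display} {T : measurableType dT}
    (h : T -> 'rV[R]_d) :
  (forall k, measurable_fun setT (fun x => h x ord0 k : measurableTypeR R)) ->
  measurable_fun setT h.
Proof.
move=> mh _ A mA; rewrite setTI.
apply: (rV_generate (fun A => measurable (h @^-1` A))) mA.
  split => [|B mB|F mF].
  - by rewrite preimage_set0.
  - by rewrite setTD preimage_setC; exact: measurableC.
  - by rewrite preimage_bigcup; exact: bigcup_measurable.
by move=> k B mB; rewrite -[X in measurable X]setTI; exact: (mh k).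
Qed.

End RowVectors.

(** * Four independent copies of a product measure *)

Definition label := (bool * bool)%type.

Local Notation l0 := (false, false).
Local Notation l1 := (false, true).
Local Notation l2 := (true, false).
Local Notation l3 := (true, true).

Section Copies.
Context {R : realType} {d : nat}.
Local Notation V := 'rV[R]_d.

Definition sample := ((V * V) * (V * V))%type.

Definition copy (a : label) (w : sample) : V :=
  let p := if a.1 then w.2 else w.1 in if a.2 then p.2 else p.1.

Definition of_copies (Y : label -> V) : sample :=
  ((Y l0, Y l1), (Y l2, Y l3)).

Definition select (s : 'I_d -> label) (w : sample) : V :=
  \row_k copy (s k) w ord0 k.

(** Each coordinate k has its own permutation p k of the four copies. *)
Definition rearrange (p : 'I_d -> label -> label) (w : sample) : sample :=
  of_copies (fun a => select (fun k => p k a) w).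

Lemma copy_of_copies a Y : copy a (of_copies Y) = Y a.
Proof. by case: a => -[] []. Qed.

Lemma copy_rearrange p a k w :
  copy a (rearrange p w) ord0 k = copy (p k a) w ord0 k.
Proof. by rewrite copy_of_copies mxE. Qed.

Lemma select_rearrange p s w :
  select s (rearrange p w) = select (fun k => p k (s k)) w.
Proof. by apply/rowP => k; rewrite !mxE copy_rearrange. Qed.

Lemma select_cst a w : select (fun=> a) w = copy a w.
Proof. by apply/rowP => k; rewrite mxE. Qed.

Lemma measurable_copy a : measurable_fun setT (copy a).
Proof.
case: a => -[] []; rewrite /copy /=.
- exact: (measurableT_comp measurable_snd measurable_snd).
- exact: (measurableT_comp measurable_fst measurable_snd).
- exact: (measurableT_comp measurable_snd measurable_fst).
- exact: (measurableT_comp measurable_fst measurable_fst).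
Qed.

Lemma measurable_entry a (k : 'I_d) :
  measurable_fun setT (fun w => copy a w ord0 k : measurableTypeR R).
Proof. exact: (measurableT_comp (measurable_coordinate k) (measurable_copy a)). Qed.

Lemma measurable_select s : measurable_fun setT (select s).
Proof.
apply: measurable_fun_rV => k.
by under eq_fun do rewrite mxE; exact: measurable_entry.
Qed.

Lemma measurable_rearrange p : measurable_fun setT (rearrange p).
Proof.
by apply/measurable_fun_pair; apply/measurable_fun_pair; exact: measurable_select.
Qed.

Definition entry (ak : label * 'I_d) (w : sample) : measurableTypeR R :=
  copy ak.1 w ord0 ak.2.

Lemma sample_generate (B : set (set sample)) : sigma_algebra setT B ->
  (forall ak (A : set (measurableTypeR R)), measurable A ->
     B (entry ak @^-1` A)) -> measurable `<=` B.
Proof.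
move=> [B0 BC BU] eB.
have sub a : measurable `<=` [set A | B (copy a @^-1` A)].
  apply: rV_generate => [|k A mA]; last exact: (eB (a, k)).
  split => [|A BA|F BF] /=.
  - by rewrite preimage_set0.
  - by rewrite setTD preimage_setC -setTD; exact: BC.
  - by rewrite preimage_bigcup; exact: BU.
have pair b : measurable `<=` [set A : set (V * V) |
    B ((fun w : sample => if b then w.2 else w.1) @^-1` A)].
  apply: smallest_sub.
    split => [|A BA|F BF] /=.
    - by rewrite preimage_set0.
    - by rewrite setTD preimage_setC -setTD; exact: BC.
    - by rewrite preimage_bigcup; exact: BU.
  move=> _ [[A mA <-]|[A mA <-]]; rewrite setTI /=.
    exact: (sub (b, false)).
  exact: (sub (b, true)).
apply: smallest_sub; first by split.
move=> _ [[A mA <-]|[A mA <-]]; rewrite setTI.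
  exact: (pair false).
exact: (pair true).
Qed.

End Copies.

Section Invariance.
Context {R : realType} {d : nat}.
Variables (mui : 'I_d -> probability (measurableTypeR R) R).
Variables (mu : probability 'rV[R]_d R).
Hypothesis mu_prod : is_product_measure mu mui.

Definition four_copies : probability sample R := ((mu \x mu) \x (mu \x mu))%E.

Lemma four_copies_box (A : label * 'I_d -> set (measurableTypeR R)) :
  (forall ak, measurable (A ak)) ->
  four_copies (box _ entry A) = (\prod_k \prod_a mui k (A (a, k)))%E.
Proof.
move=> mA.
pose r a : set 'rV[R]_d := [set x | forall k, A (a, k) (x ord0 k)].
have mr a : measurable (r a).
  exact: (measurable_box _ coordinate measurable_coordinate (fun k => A (a, k))).
have -> : box _ entry A = (r l0 `*` r l1) `*`
   (r l2 `*` r l3).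
  apply/seteqP; split => [[[x y] [z t]] H|[[x y] [z t]] [[Hx Hy] [Hz Ht]]].
    split; split => k.
    - exact: (H (l0, k)).
    - exact: (H (l1, k)).
    - exact: (H (l2, k)).
    - exact: (H (l3, k)).
  by move=> [[[] []] k]; [exact: Ht|exact: Hz|exact: Hy|exact: Hx].
have mr2 a b : measurable (r a `*` r b) by exact: measurableX.
have mur a : mu (r a) = (\prod_k mui k (A (a, k)))%E.
  exact: (mu_prod (fun k => A (a, k))).
transitivity ((mu (r l0) * mu (r l1)) *
    (mu (r l2) * mu (r l3)))%E.
  rewrite [LHS]product_measure1E// [X in (X * _)%E]product_measure1E//.
  by rewrite [X in (_ * X)%E]product_measure1E.
rewrite !mur exchange_big /=.
rewrite [RHS](eq_bigr (fun a => \prod_(k < d) mui k (A ((a.1, a.2), k)))%E); last first.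
  by case.
rewrite -(pair_bigA _ (fun a b => \prod_(j < d) mui j (A ((a, b), j)))%E) /=.
by rewrite !big_bool /= muleC; congr (_ * _)%E; rewrite muleC.
Qed.

(** The measure of a box is a double product over the coordinates and the
    copies, and a permutation of the copies only reindexes the inner product. *)
Lemma four_copies_rearrange (p : 'I_d -> label -> label) :
  (forall k, injective (p k)) ->
  forall A, measurable A -> four_copies (rearrange p @^-1` A) = four_copies A.
Proof.
move=> pI A mA.
have mp := @measurable_rearrange R d p.
pose T : {mfun sample >-> sample} := HB.pack (rearrange p) (isMeasurableFun.Build _ _ _ _ _ mp).
refine (box_unique _ entry sample_generate _ (distribution four_copies T) four_copies _ A mA).
  by case=> a k; exact: measurable_entry.
clear A mA => A mA.
refine (etrans _ (esym (four_copies_box A mA))).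
change (four_copies (rearrange p @^-1` box _ entry A) =
  (\prod_k \prod_a mui k (A (a, k)))%E).
pose A' (ak : label * 'I_d) := A (invF (pI ak.2) ak.1, ak.2).
have -> : rearrange p @^-1` box _ entry A = box _ entry A'.
  apply/seteqP; split => w H [a k].
    have := H (invF (pI k) a, k).
    by rewrite /entry /= copy_rearrange f_invF.
  have := H (p k a, k).
  by rewrite /entry /A' /= copy_rearrange invF_f.
refine (etrans (four_copies_box A' _) _); first by move=> [a k]; exact: mA.
apply: eq_bigr => k _; rewrite (reindex_inj (pI k)) /=.
by apply: eq_bigr => a _; rewrite /A' /= invF_f.
Qed.

End Invariance.

(** * Averaging over permutations of the copies *)

Definition labels : seq label := [:: l0; l1; l2; l3].
(** A permutation of the labels, given by the list of its values: lists can be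
    enumerated by computation. *)
Definition relabel (s : seq label) (a : label) : label := nth l0 s (a.1.*2 + a.2)%N.

(** The integrand of the diagonal step: F a and G a are the values of f and g when
    the i-th entry is that of the copy a, and x a is this entry. The factor
    (x l2 - x l3) ^+ 2 / 2 has the variance as its mean and is independent of
    the factor that it multiplies. *)
Definition diagonal_form {R : realFieldType} (F G x : label -> R) : R :=
  2^-1 * (F l0 * (G l0 - G l1) * (x l2 - x l3) ^+ 2)
  - F l0 * G l1 * (x l0 - x l2) * (x l1 - x l3).

Definition label_det {R : realFieldType} (F x : label -> R) a b c :=
  F a * (x b - x c) + F b * (x c - x a) + F c * (x a - x b).

Lemma relabel_inj s : perm_eq s labels -> injective (relabel s).
Proof.
move=> sl; have us : uniq s by rewrite (perm_uniq sl).
have ss : size s = 4 by rewrite (perm_size sl).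
move=> [a b] [a' b'] /eqP; rewrite nth_uniq ?ss //;
  [|by case: a; case: b|by case: a'; case: b'].
by case: a; case: b; case: a'; case: b'.
Qed.

(** The sampled form of the identity
    Var(x) Cov(F, G) - Cov(F, x) Cov(G, x) = E[D_F D_G] / 6
    for the Gram determinant, D_F being the determinant of (1, x, F) at three
    independent points. *)
Lemma sum_diagonal_form {R : realFieldType} (F G x : label -> R) :
  \sum_(s <- permutations labels)
     diagonal_form (F \o relabel s) (G \o relabel s) (x \o relabel s) =
  label_det F x l0 l1 l2 * label_det G x l0 l1 l2 + label_det F x l0 l1 l3 * label_det G x l0 l1 l3
  + label_det F x l0 l2 l3 * label_det G x l0 l2 l3 + label_det F x l1 l2 l3 * label_det G x l1 l2 l3.
Proof.
set P := permutations _; vm_compute in P; rewrite {}/P.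
rewrite !big_cons big_nil /diagonal_form /label_det /relabel /=.
by field.
Qed.

Lemma relabel_exists (a c : label) : a != c ->
  exists2 s, perm_eq s labels & relabel s l0 = c /\ relabel s l2 = a.
Proof.
move=> ac.
suff /hasP[s] : has (fun s => (relabel s l0 == c) && (relabel s l2 == a)) (permutations labels).
  by rewrite mem_permutations => sP /andP[/eqP e1 /eqP e2]; exists s.
by move: a c ac => [[] []] [[] []]; vm_compute.
Qed.

(** A pair of permutations of the copies, acting in the coordinates i and j
    only. *)
Definition two_columns {d : nat} (i j : 'I_d) (t : seq label * seq label)
    (k : 'I_d) : label -> label :=
  if k == i then relabel t.1 else if k == j then relabel t.2 else id.

Lemma two_columns_inj {d : nat} (i j : 'I_d) t k :
  perm_eq t.1 labels -> perm_eq t.2 labels -> injective (two_columns i j t k).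
Proof.
by move=> t1 t2; rewrite /two_columns; case: ifP => _; [|case: ifP => _ //];
  exact: relabel_inj.
Qed.

Definition at_column {d : nat} (s : 'I_d -> label) (i : 'I_d) (a : label)
    (k : 'I_d) : label := if k == i then a else s k.

Lemma select_at_column {R : realType} {d : nat} (s : 'I_d -> label) i a
    (w : @sample R d) :
  select (at_column s i a) w = set_coord i (copy a w ord0 i) (select s w).
Proof. by apply/rowP => k; rewrite !mxE /at_column; case: eqP => [->|]. Qed.

Section Symmetrization.
Context {R : realType} {d : nat}.
Variables (mui : 'I_d -> probability (measurableTypeR R) R).
Variables (mu : probability 'rV[R]_d R).
Hypothesis mu_prod : is_product_measure mu mui.
Local Notation Q := (four_copies mu).
Implicit Types (h : @sample R d -> R) (p : 'I_d -> label -> label).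

Lemma Lfun1_rearrange p h : (forall k, injective (p k)) ->
  h \in Lfun Q 1 -> h \o rearrange p \in Lfun Q 1.
Proof.
move=> pI; apply: Lfun1_preserving; first exact: measurable_rearrange.
exact: four_copies_rearrange mu_prod p pI.
Qed.

Lemma Lfun2_rearrange p h : (forall k, injective (p k)) ->
  h \in Lfun Q 2%:E -> h \o rearrange p \in Lfun Q 2%:E.
Proof.
move=> pI; apply: Lfun2_preserving; first exact: measurable_rearrange.
exact: four_copies_rearrange mu_prod p pI.
Qed.

Lemma Ex_rearrange p h : (forall k, injective (p k)) ->
  h \in Lfun Q 1 -> Ex Q (h \o rearrange p) = Ex Q h.
Proof.
move=> pI; apply: Ex_preserving; first exact: measurable_rearrange.
exact: four_copies_rearrange mu_prod p pI.
Qed.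

(** All the summands have the same expectation as h. *)
Lemma Ex_ge0_symmetrize (I : eqType) (L : seq I) (p : I -> 'I_d -> label -> label) h :
  (0 < size L)%N -> (forall t k, t \in L -> injective (p t k)) ->
  h \in Lfun Q 1 ->
  (forall w, 0 <= \sum_(t <- L) h (rearrange (p t) w)) -> 0 <= Ex Q h.
Proof.
move=> L0 pI h1 hp.
have [S1 SE] : (fun w => \sum_(t <- L) h (rearrange (p t) w)) \in Lfun Q 1 /\
    Ex Q (fun w => \sum_(t <- L) h (rearrange (p t) w)) = (size L)%:R * Ex Q h.
  elim: L pI {L0 hp} => [|t L IH] pI.
    under eq_fun do rewrite big_nil.
    by rewrite mul0r; split; [exact: Lfun1_cst|exact: Ex_cst].
  have [|IH1 IH2] := IH; first by move=> t' k t'L; apply: pI; rewrite inE t'L orbT.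
  under eq_fun do rewrite big_cons.
  have pt k : injective (p t k) by apply: pI; rewrite inE eqxx.
  have ht := Lfun1_rearrange (p t) h pt h1.
  split; first exact: (Lfun_add Q 1 _ _ (lexx _) ht IH1).
  rewrite (ExD Q _ _ ht IH1) IH2 (Ex_rearrange (p t) h pt h1) /=.
  by rewrite -[in RHS]addn1 natrD mulrDl mul1r addrC.
have : 0 <= (size L)%:R * Ex Q h by rewrite -SE; exact: Ex_ge0.
by rewrite pmulr_rge0 // ltr0n.
Qed.

(** The vector picked by s has law mu. *)
Lemma Lfun2_select (u : 'rV[R]_d -> R) s :
  u \in Lfun mu 2%:E -> (fun w => u (select s w)) \in Lfun Q 2%:E.
Proof.
move=> u2.
(* The factors 1 put the function of the single copy l0 in the shape of a
   function with separated variables. *)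
have base : (fun w : @sample R d => (u w.1.1 * 1) * 1) \in Lfun Q 2%:E.
  apply: (Lfun2_prod (mu \x mu)%E (mu \x mu)%E (fun z => u z.1 * 1) (fun=> 1));
    last exact: Lfun2_cst.
  apply: (Lfun2_prod mu mu u (fun=> 1)) => //; exact: Lfun2_cst.
have ex k : exists2 t, perm_eq t labels & relabel t l0 = s k.
  have [a ac] : exists a, a != s k by exists (~~ (s k).1, true); case: (s k) => -[] [].
  by have [t tP [t0 _]] := relabel_exists a (s k) ac; exists t.
pose t k := projT1 (cid2 (ex k)).
have tP k : perm_eq (t k) labels by rewrite /t; case: cid2.
have tE k : relabel (t k) l0 = s k by rewrite /t; case: cid2.
have := Lfun2_rearrange (fun k => relabel (t k)) _ (fun k => relabel_inj _ (tP k)) base.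
rewrite (_ : _ \o _ = (fun w => u (select s w))) //.
apply/funext => w /=; rewrite !mulr1; congr (u _).
by apply/rowP => k; rewrite !mxE tE.
Qed.

(** The two factors are independent because the i-th entries that they use come
    from different copies; without this, the product of two square-integrable
    functions would only be integrable. *)
Lemma Lfun2_select_copy (u : 'rV[R]_d -> R) (s : 'I_d -> label) i a : a != s i ->
  u \in Lfun mu 2%:E -> coordinate i \in Lfun mu 2%:E ->
  (fun w => u (select s w) * copy a w ord0 i) \in Lfun Q 2%:E.
Proof.
move=> ai u2 v2; pose v : 'rV[R]_d -> R := coordinate i.
have base : (fun w : @sample R d => (u w.1.1 * 1) * (v w.2.1 * 1)) \in Lfun Q 2%:E.
  apply: (Lfun2_prod (mu \x mu)%E (mu \x mu)%E (fun z => u z.1 * 1) (fun z => v z.1 * 1)).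
    apply: (Lfun2_prod mu mu u (fun=> 1)) => //; exact: Lfun2_cst.
  apply: (Lfun2_prod mu mu v (fun=> 1)) => //; exact: Lfun2_cst.
(* In each column move l0 to the copy chosen by s; in column i, moreover, move
   l2 to a. *)
have ex k : exists t, [/\ perm_eq t labels, relabel t l0 = s k & (k = i -> relabel t l2 = a)].
  have [b [bc bi]] : exists b, b != s k /\ (k = i -> b = a).
    have [->|ki] := eqVneq k i; first by exists a.
    exists (~~ (s k).1, true); split; first by case: (s k) => -[] [].
    by move=> E; rewrite E eqxx in ki.
  have [t tP [t0 t2]] := relabel_exists b (s k) bc; exists t; split => //.
  by move=> /bi <-.
pose t k := projT1 (cid (ex k)).
have tP k : perm_eq (t k) labels by rewrite /t; case: cid => ? [].
have tE k : relabel (t k) l0 = s k by rewrite /t; case: cid => ? [].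
have ti : relabel (t i) l2 = a by rewrite /t; case: cid => ? [? ? H]; exact: H.
have := Lfun2_rearrange (fun k => relabel (t k)) _ (fun k => relabel_inj _ (tP k)) base.
rewrite (_ : _ \o _ = (fun w => u (select s w) * copy a w ord0 i)) //.
apply/funext => w /=; rewrite !mulr1; congr (u _ * _).
  by apply/rowP => k; rewrite !mxE tE.
by rewrite /v /coordinate !mxE ti.
Qed.

End Symmetrization.

(** * Covariances as expectations over independent copies *)

Section Covariance.
Context {R : realType} {dT : measure_display} {T : measurableType dT}.
Variable P : probability T R.
Local Notation P2 := ((P \x P)%E : probability _ R).
Implicit Types u v : T -> R.

Definition cov u v : R := Ex P (fun x => u x * v x) - Ex P u * Ex P v.

Lemma covarianceEx u v : u \in Lfun P 2%:E -> v \in Lfun P 2%:E ->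
  covariance P u v = (cov u v)%:E.
Proof.
move=> u2 v2; rewrite covarianceE; [|exact: Lfun21|exact: Lfun21|exact: Lfun_mul2].
rewrite (expectationEx P (u * v)%R (Lfun_mul2 _ _ _ u2 v2)).
by rewrite !expectationEx ?Lfun21.
Qed.

Lemma Lfun1_cov u v : u \in Lfun P 2%:E -> v \in Lfun P 2%:E ->
  (fun z => u z.1 * (v z.1 - v z.2)) \in Lfun P2 1.
Proof.
move=> u2 v2; under eq_fun do rewrite mulrBr -[X in X - _]mulr1.
apply: Lfun_sub => //.
  apply: (Lfun1_prod P P (fun x => u x * v x) (fun=> 1)); first exact: Lfun_mul2.
  exact: Lfun1_cst.
by apply: Lfun1_prod; exact: Lfun21.
Qed.

Lemma Ex_cov u v : u \in Lfun P 2%:E -> v \in Lfun P 2%:E ->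
  Ex P2 (fun z => u z.1 * (v z.1 - v z.2)) = cov u v.
Proof.
move=> u2 v2; under eq_fun do rewrite mulrBr -[X in X - _]mulr1.
have uv1 := Lfun_mul2 _ _ _ u2 v2.
rewrite ExB; last 2 first.
- by apply: (Lfun1_prod P P (fun x => u x * v x) (fun=> 1)) => //; exact: Lfun1_cst.
- by apply: Lfun1_prod; exact: Lfun21.
rewrite (Ex_prod P P (fun x => u x * v x) (fun=> 1) uv1 (Lfun1_cst P 1)).
by rewrite (Ex_prod P P u v (Lfun21 _ _ u2) (Lfun21 _ _ v2)) Ex_cst mulr1.
Qed.

Lemma Lfun1_half_sqr u : u \in Lfun P 2%:E ->
  (fun z => 2^-1 * (u z.1 - u z.2) ^+ 2) \in Lfun P2 1.
Proof.
move=> u2.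
have d2 : (fun z => u z.1 * 1 - 1 * u z.2) \in Lfun P2 2%:E.
  apply: Lfun_sub; first by rewrite lee1n.
    by apply: (Lfun2_prod P P u (fun=> 1)) => //; exact: Lfun2_cst.
  by apply: (Lfun2_prod P P (fun=> 1) u) => //; exact: Lfun2_cst.
apply: eq_Lfun (Lfun_mul2 _ _ _ (Lfun2_mulr P2 _ 2^-1 d2) d2) => z /=.
by rewrite mulr1 mul1r; ring.
Qed.

Lemma Ex_half_sqr u : u \in Lfun P 2%:E ->
  Ex P2 (fun z => 2^-1 * (u z.1 - u z.2) ^+ 2) = cov u u.
Proof.
move=> u2; have u1 := Lfun21 _ _ u2; have uu1 := Lfun_mul2 _ _ _ u2 u2.
have c1 : (fun z => u z.1 * (u z.1 - u z.2)) \in Lfun P2 1 by exact: Lfun1_cov.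
(* The difference with the integrand for cov u u is antisymmetric in the two
   copies. *)
have e : (fun z => u z.1 * (u z.1 - u z.2) - 2^-1 * (u z.1 - u z.2) ^+ 2) =
   (fun z => (2^-1 * (u z.1 * u z.1)) * 1 - 1 * (2^-1 * (u z.2 * u z.2))).
  by apply/funext => z; field.
have := ExB _ _ _ c1 (Lfun1_half_sqr _ u2); rewrite Ex_cov // e.
have h1 : (fun x => 2^-1 * (u x * u x)) \in Lfun P 1.
  by apply: eq_Lfun (Lfun_mul2 _ _ _ (Lfun2_mulr P _ 2^-1 u2) u2) => z /=; ring.
pose hh x := 2^-1 * (u x * u x).
rewrite (ExB _ (fun z => hh z.1 * 1) (fun z => 1 * hh z.2)); last 2 first.
- by apply: (Lfun1_prod P P hh (fun=> 1)) => //; exact: Lfun1_cst.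
- by apply: (Lfun1_prod P P (fun=> 1) hh) => //; exact: Lfun1_cst.
rewrite (Ex_prod P P hh (fun=> 1) h1 (Lfun1_cst P 1)).
rewrite (Ex_prod P P (fun=> 1) hh (Lfun1_cst P 1) h1) mulrC subrr => /eqP.
by rewrite eq_sym subr_eq0 => /eqP.
Qed.

End Covariance.


(** * The diagonal and the mixed step *)

Section FirstFactor.
Context {R : realType} {d1 d2 : measure_display}
  {T1 : measurableType d1} {T2 : measurableType d2}.
Variables (P1 : probability T1 R) (P2 : probability T2 R).
Local Notation P := ((P1 \x P2)%E : probability _ R).

Lemma fst_preserving A : measurable A -> P (fst @^-1` A) = P1 A.
Proof.
move=> mA; have -> : fst @^-1` A = A `*` [set: T2].
  by apply/seteqP; split => [[x y] //|[x y] [] //].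
by rewrite [LHS]product_measure1E// [X in (_ * X)%E]probability_setT mule1.
Qed.

End FirstFactor.

Section Steps.
Context {R : realType} {d : nat}.
Variables (mui : 'I_d -> probability (measurableTypeR R) R).
Variables (mu : probability 'rV[R]_d R).
Hypothesis mu_prod : is_product_measure mu mui.
Hypothesis coord2 : forall i, coordinate i \in Lfun mu 2%:E.
Local Notation Q := (four_copies mu).
Local Notation mu2 := ((mu \x mu)%E : probability _ R).
Implicit Types (h : @sample R d -> R) (s : 'I_d -> label) (i j : 'I_d).

Lemma Lfun1_first_pair h : h \in Lfun Q 1 -> (forall w, h w = h (w.1, w.1)) ->
  (fun z => h (z, z)) \in Lfun mu2 1.
Proof.
move=> h1 hE.
rewrite -(Lfun1_preservingE Q mu2 fst measurable_fst (fst_preserving _ _)).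
  by apply: eq_Lfun h1 => w /=; exact: hE.
apply: (measurableT_comp (Lfun_measurable _ _ _ h1)).
by apply: measurable_fun_pair; exact: measurable_id.
Qed.

(** The condition on h says that it depends on the first pair of copies only. *)
Lemma Ex_split h (k : 'rV[R]_d * 'rV[R]_d -> R) :
  h \in Lfun Q 1 -> (forall w, h w = h (w.1, w.1)) -> k \in Lfun mu2 1 ->
  (fun w => h w * k w.2) \in Lfun Q 1 /\
  Ex Q (fun w => h w * k w.2) = Ex Q h * Ex mu2 k.
Proof.
move=> h1 hE k1; have H1 := Lfun1_first_pair h h1 hE.
under eq_fun do rewrite hE.
split; first exact: (Lfun1_prod mu2 mu2 (fun z => h (z, z)) k H1 k1).
rewrite (Ex_prod mu2 mu2 (fun z => h (z, z)) k H1 k1); congr (_ * _).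
rewrite -(Ex_preserving Q mu2 fst measurable_fst (fst_preserving _ _) _ H1).
by congr Ex; apply/funext => w /=.
Qed.

Lemma select_first_pair s (w : @sample R d) : (forall k, (s k).1 = false) ->
  select s w = select s (w.1, w.1).
Proof. by move=> s1; apply/rowP => k; rewrite !mxE /copy s1. Qed.

Lemma at_column_rearrange s i j a b t (w : @sample R d) : i != j ->
  select (at_column (at_column s j b) i a) (rearrange (two_columns i j t) w) =
  select (at_column (at_column s j (relabel t.2 b)) i (relabel t.1 a)) w.
Proof.
move=> ij; apply/rowP => k; rewrite !mxE copy_rearrange /two_columns /at_column.
by case: (eqVneq k i) => // _; case: (eqVneq k j).
Qed.

Lemma at_column_rearrange1 s i a t (w : @sample R d) :
  select (at_column s i a) (rearrange (two_columns i i t) w) =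
  select (at_column s i (relabel t.1 a)) w.
Proof.
apply/rowP => k; rewrite !mxE copy_rearrange /two_columns /at_column.
by case: (eqVneq k i).
Qed.

Variables f g : 'rV[R]_d -> R.
Hypotheses (f2 : f \in Lfun mu 2%:E) (g2 : g \in Lfun mu 2%:E).

Local Notation x a i := (fun w : sample => copy a w ord0 i).

Lemma Lfun2_select_copyB (u : 'rV[R]_d -> R) s i a b : u \in Lfun mu 2%:E ->
  a != s i -> b != s i ->
  (fun w => u (select s w) * (x a i w - x b i w)) \in Lfun Q 2%:E.
Proof.
move=> u2 sa sb; under eq_fun do rewrite mulrBr.
by apply: Lfun_sub; [rewrite lee1n|exact: (Lfun2_select_copy mui)..].
Qed.

(** Its mean is the quantity C of the introduction for the vector picked by s.
    The i-th increments are taken between disjoint pairs of copies so that, when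
    s is constantly l1, the integrand factors over (l0, l2) and (l1, l3). *)
Definition cross s i (w : sample) : R :=
  f (select (fun=> l0) w) * g (select s w) *
  (x l0 i w - x l2 i w) * (x l1 i w - x l3 i w).

(** The increments are exchanged: f, which uses the i-th entry of l0, is grouped
    with the increment between l1 and l3, and g with the other one. *)
Lemma Lfun1_cross s i : s i = l1 -> cross s i \in Lfun Q 1.
Proof.
move=> si.
have F2 := Lfun2_select_copyB f (fun=> l0) i l1 l3 f2 isT isT.
have G2 : (fun w => g (select s w) * (x l0 i w - x l2 i w)) \in Lfun Q 2%:E.
  by apply: Lfun2_select_copyB => //; rewrite si.
by apply: eq_Lfun (Lfun_mul2 _ _ _ F2 G2) => w; rewrite /cross; ring.
Qed.

(** The variance is the mean of half the squared difference of the i-th entries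
    of l2 and l3, which is independent of the rest of the integrand as s only
    uses l0 and l1. The difference of the two sides is then the mean of
    [diagonal_form], and the 24 permutations of the column i turn it into a sum
    of products of determinants of equal sign. *)
Lemma diagonal_step s i :
  s i = l0 -> (forall k, (s k).1 = false) ->
  has_partial i f -> has_partial i g ->
  has_partial i (partial i f) -> has_partial i (partial i g) ->
  same_constant_sign (partial i (partial i f)) (partial i (partial i g)) ->
  Ex Q (cross (at_column s i l1) i) <=
  cov mu (coordinate i) (coordinate i) *
  Ex Q (fun w => f (select (fun=> l0) w) *
    (g (select s w) - g (select (at_column s i l1) w))).
Proof.
move=> si s1 fi gi fii gii sgn.
pose s' := at_column s i l1.
have Es : s = at_column s i l0 by apply/funext => k; rewrite /at_column; case: eqP => // ->.
have E0 : (fun=> l0) = at_column (fun=> l0) i l0 :> ('I_d -> label).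
  by apply/funext => k; rewrite /at_column; case: eqP.
pose h w := f (select (fun=> l0) w) * (g (select s w) - g (select s' w)).
have h1 : h \in Lfun Q 1.
  apply: (Lfun_mul2 Q (fun w => f (select (fun=> l0) w)) (fun w => _ - _)).
    exact: (Lfun2_select mui).
  by apply: Lfun_sub; [rewrite lee1n|exact: (Lfun2_select mui)..].
have hE w : h w = h (w.1, w.1).
  rewrite /h (select_first_pair (fun=> l0)) // (select_first_pair s) //.
  by rewrite (select_first_pair s') // => k; rewrite /s' /at_column; case: ifP.
have k1 := Lfun1_half_sqr mu _ (coord2 i).
have [hk1 hkE] := Ex_split h _ h1 hE k1.
have c1 : cross s' i \in Lfun Q 1.
  by apply: Lfun1_cross; rewrite /s' /at_column eqxx.
rewrite Ex_half_sqr // in hkE.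
rewrite mulrC -/h -hkE -subr_ge0 -(ExB _ _ _ hk1 c1).
apply: (Ex_ge0_symmetrize _ _ mu_prod _ (permutations labels)
  (fun t => two_columns i i (t, t))).
- by [].
- by move=> t k; rewrite mem_permutations => tP; exact: two_columns_inj.
- by apply: Lfun_sub.
move=> w; pose F a := f (select (at_column (fun=> l0) i a) w).
pose G a := g (select (at_column s i a) w).
rewrite (eq_bigr (fun t => diagonal_form (F \o relabel t) (G \o relabel t) ((fun a => x a i w) \o relabel t))).
  rewrite sum_diagonal_form.
  have D a b c : 0 <= label_det F (fun a => x a i w) a b c * label_det G (fun a => x a i w) a b c.
    rewrite /label_det /F /G !select_at_column.
    exact: (chord_det_same_sign f g i (select (fun=> l0) w) (select s w)).
  by rewrite !addr_ge0.
move=> t _; set r := rearrange _ w.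
change (coordinate i r.2.1) with (copy l2 r ord0 i).
change (coordinate i r.2.2) with (copy l3 r ord0 i).
have Ff a : f (select (at_column (fun=> l0) i a) r) = F (relabel t a).
  by rewrite /r at_column_rearrange1.
have Gg a : g (select (at_column s i a) r) = G (relabel t a).
  by rewrite /r at_column_rearrange1.
rewrite /h /cross /s' [in RHS]/diagonal_form /= -!Ff -!Gg -E0 -Es.
rewrite !copy_rearrange /two_columns eqxx /=; ring.
Qed.

(** In the column i exchange l0 with l2, which turns f into a difference, and l1
    with l3, which does the same for g; in the column j exchange l0 with l1, which
    completes both into mixed differences. *)
Lemma mixed_step s i j : i != j -> s i = l1 -> s j = l0 ->
  has_partial i f -> has_partial i g ->
  has_partial j (partial i f) -> has_partial j (partial i g) ->
  same_constant_sign (partial j (partial i f)) (partial j (partial i g)) ->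
  Ex Q (cross (at_column s j l1) i) <= Ex Q (cross s i).
Proof.
move=> ij si sj fi gi fij gij sgn.
pose F a b w := f (select (at_column (at_column (fun=> l0) j b) i a) w).
pose G a b w := g (select (at_column (at_column s j b) i a) w).
have E0 : (fun=> l0) = at_column (at_column (fun=> l0) j l0) i l0 :> ('I_d -> label).
  by apply/funext => k; rewrite /at_column; case: eqP => //; case: eqP.
have Es : s = at_column (at_column s j l0) i l1.
  by apply/funext => k; rewrite /at_column; case: eqP => [->|_] //; case: eqP => [->|].
have Es' : at_column s j l1 = at_column (at_column s j l1) i l1.
  apply/funext => k; rewrite /at_column; have [->|//] := eqVneq k i.
  by rewrite (negbTE ij) si.
have c1 : cross s i \in Lfun Q 1 by exact: Lfun1_cross.
have c1' : cross (at_column s j l1) i \in Lfun Q 1.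
  by apply: Lfun1_cross; rewrite /at_column (negbTE ij).
rewrite -subr_ge0 -(ExB _ _ _ c1 c1').
pose sigma : seq (seq label) :=
  [:: labels; [:: l2; l1; l0; l3]; [:: l0; l3; l2; l1]; [:: l2; l3; l0; l1]].
pose tau : seq (seq label) := [:: labels; [:: l1; l0; l2; l3]].
apply: (Ex_ge0_symmetrize _ _ mu_prod _ (allpairs pair sigma tau)
  (fun t => two_columns i j t)).
- by [].
- move=> t k /allpairsP[[a b] /= [aS bT ->]]; apply: two_columns_inj => /=.
    have /allP : all (fun t => perm_eq t labels) sigma by vm_compute.
    exact.
  have /allP : all (fun t => perm_eq t labels) tau by vm_compute.
  exact.
- by apply: Lfun_sub.
move=> w.
have D := mixed_diff_same_sign f g i j (select (fun=> l0) w) (select s w)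
  (x l0 i w) (x l2 i w) (x l0 j w) (x l1 j w) (x l1 i w) (x l3 i w) ij fi gi fij gij sgn.
rewrite /mixed_diff -!select_at_column in D.
rewrite (eq_bigr (fun t : seq label * seq label =>
  F (relabel t.1 l0) (relabel t.2 l0) w *
  (G (relabel t.1 l1) (relabel t.2 l0) w - G (relabel t.1 l1) (relabel t.2 l1) w) *
  (x (relabel t.1 l0) i w - x (relabel t.1 l2) i w) *
  (x (relabel t.1 l1) i w - x (relabel t.1 l3) i w))); last first.
  move=> t _; set r := rearrange _ w.
  have Ff a b : f (select (at_column (at_column (fun=> l0) j b) i a) r) =
      F (relabel t.1 a) (relabel t.2 b) w by rewrite /r at_column_rearrange.
  have Gg a b : g (select (at_column (at_column s j b) i a) r) =
      G (relabel t.1 a) (relabel t.2 b) w by rewrite /r at_column_rearrange.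
  rewrite /cross -!Ff -!Gg -E0 -Es -Es'.
  rewrite !copy_rearrange /two_columns eqxx /=; ring.
rewrite /= !big_cons big_nil /relabel /=.
apply: le_trans D _; rewrite le_eqVlt; apply/orP; left; apply/eqP.
rewrite /F /G; ring.
Qed.

Definition prefix_labels (m : nat) (k : 'I_d) : label := if (k < m)%N then l1 else l0.

Lemma prefix_labelsS (m : 'I_d) : prefix_labels m.+1 = at_column (prefix_labels m) m l1.
Proof.
apply/funext => k; rewrite /prefix_labels /at_column ltnS leq_eqVlt.
by rewrite -(inj_eq val_inj); case: eqP.
Qed.

Lemma cross_prefix i (m : nat) :
  has_partial i f -> has_partial i g ->
  (forall j, has_partial j (partial i f)) -> (forall j, has_partial j (partial i g)) ->
  (forall j, same_constant_sign (partial j (partial i f)) (partial j (partial i g))) ->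
  (i < m <= d)%N ->
  Ex Q (cross (prefix_labels m) i) <= Ex Q (cross (prefix_labels i.+1) i).
Proof.
move=> fi gi fij gij sgn; elim: m => // m IH /andP[im md].
move: im; rewrite ltnS leq_eqVlt => /predU1P[<-//|im].
apply: le_trans (IH _); last by rewrite im ltnW.
have -> : prefix_labels m.+1 = at_column (prefix_labels m) (Ordinal md) l1.
  exact: (prefix_labelsS (Ordinal md)).
apply: (mixed_step (prefix_labels m) i (Ordinal md) _ _ _ fi gi (fij _) (gij _) (sgn _)).
- by rewrite -(inj_eq val_inj) /= neq_ltn im.
- by rewrite /prefix_labels im.
- by rewrite /prefix_labels ltnn.
Qed.

(** Exchanging the copies l1 and l2 in every column makes the integrand a
    product of a function of the first pair of copies and one of the second. *)
Lemma cross_prefix_last i :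
  Ex Q (cross (prefix_labels d) i) = cov mu f (coordinate i) * cov mu g (coordinate i).
Proof.
pose t : seq label := [:: l0; l2; l1; l3].
have tI (k : 'I_d) : injective (relabel t) by apply: relabel_inj; vm_compute.
have c1 : cross (prefix_labels d) i \in Lfun Q 1.
  by apply: Lfun1_cross; rewrite /prefix_labels ltn_ord.
rewrite -(Ex_rearrange _ _ mu_prod (fun=> relabel t) _ tI c1).
have [fc gc] := (Lfun1_cov _ _ _ f2 (coord2 i), Lfun1_cov _ _ _ g2 (coord2 i)).
rewrite -!Ex_cov // -(Ex_prod _ _ _ _ fc gc).
congr Ex; apply/funext => w /=.
have e0 : select (fun=> l0) (rearrange (fun=> relabel t) w) = w.1.1.
  by rewrite select_rearrange select_cst.
have e1 : select (prefix_labels d) (rearrange (fun=> relabel t) w) = w.2.1.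
  rewrite select_rearrange -[RHS](select_cst l2); congr select.
  by apply/funext => k; rewrite /prefix_labels ltn_ord.
by rewrite /cross e0 e1 !copy_rearrange /= /copy /coordinate /=; ring.
Qed.

(** The sum over i telescopes along the vectors that agree with l1 in the first i
    coordinates and with l0 in the others. *)
Lemma covariance_bound :
  (forall i, 0 < cov mu (coordinate i) (coordinate i)) ->
  (forall i, has_partial i f) -> (forall i, has_partial i g) ->
  (forall i j, has_partial i (partial j f)) -> (forall i j, has_partial i (partial j g)) ->
  (forall i j, same_constant_sign (partial i (partial j f)) (partial i (partial j g))) ->
  \sum_(i < d) (cov mu (coordinate i) (coordinate i))^-1 *
     (cov mu f (coordinate i) * cov mu g (coordinate i)) <= cov mu f g.
Proof.
move=> V0 fi gi fij gij sgn.
pose T m w := f (select (fun=> l0) w) * g (select (prefix_labels m) w).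
have T1 m : T m \in Lfun Q 1.
  by apply: (Lfun_mul2 Q (fun w => f (select _ w)) (fun w => g (select _ w)));
    exact: (Lfun2_select mui).
have -> : cov mu f g = \sum_(i < d) (Ex Q (T i) - Ex Q (T i.+1)).
  have sE n : \sum_(i < n) (Ex Q (T i) - Ex Q (T i.+1)) = Ex Q (T 0%N) - Ex Q (T n).
    elim: n => [|n IH]; first by rewrite big_ord0 subrr.
    by rewrite big_ord_recr /= IH; ring.
  rewrite sE -(ExB _ _ _ (T1 _) (T1 _)) -(Ex_cov _ _ _ f2 g2).
  have fg1 := Lfun1_cov _ _ _ f2 g2.
  rewrite -(Ex_preserving Q mu2 fst measurable_fst (fst_preserving _ _) _ fg1).
  congr Ex; apply/funext => w /=; rewrite /T mulrBr.
  have e0 : select (fun=> l0) w = w.1.1 by rewrite select_cst.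
  have e2 : select (prefix_labels d) w = w.1.2.
    rewrite -[RHS](select_cst l1); congr select.
    by apply/funext => k; rewrite /prefix_labels ltn_ord.
  by rewrite e0 e2.
apply: ler_sum => i _; rewrite -ler_pdivlMl ?invr_gt0 // invrK -(ExB _ _ _ (T1 _) (T1 _)).
rewrite -cross_prefix_last.
have id : (i < d <= d)%N by rewrite ltn_ord leqnn.
have C := cross_prefix i d (fi i) (gi i) (fij^~ i) (gij^~ i) (sgn^~ i) id.
apply: (le_trans C).
have := diagonal_step (prefix_labels i) i.
rewrite -prefix_labelsS => H; apply: le_trans (H _ _ _ _ _ _ _) _ => //.
- by rewrite /prefix_labels ltnn.
- by move=> k; rewrite /prefix_labels; case: ifP.
rewrite le_eqVlt; apply/orP; left; apply/eqP; congr (_ * Ex _ _).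
by apply/funext => w; rewrite /T mulrBr.
Qed.

End Steps.

(** * The marginals, and the theorem *)

Section Marginals.
Context {R : realType} {d : nat}.
Variables (mui : 'I_d -> probability (measurableTypeR R) R).
Variables (mu : probability 'rV[R]_d R).
Hypothesis mu_prod : is_product_measure mu mui.

Lemma coordinate_preserving i A : measurable A ->
  mu ((coordinate i : _ -> measurableTypeR R) @^-1` A) = mui i A.
Proof.
move=> mA; pose B k := if k == i then A else setT.
have -> : (coordinate i : _ -> measurableTypeR R) @^-1` A =
    [set x : 'rV[R]_d | forall k, B k (x ord0 k)].
  apply/seteqP; split => x /= H.
    by move=> k; rewrite /B; case: eqP => [->|].
  by have := H i; rewrite /B eqxx.
rewrite mu_prod; last by move=> k; rewrite /B; case: ifP.
rewrite (bigD1 i) //= big1 => [|k /negbTE ki]; rewrite /B ?eqxx ?mule1 //.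
by rewrite ki probability_setT.
Qed.

Lemma Lfun2_idfun (P : probability (measurableTypeR R) R) :
  ('E_P[fun x : measurableTypeR R => ((x : R) ^+ 2)%R] < +oo)%E ->
  (idfun : measurableTypeR R -> R) \in Lfun P 2%:E.
Proof.
move=> fin; have mid : measurable_fun setT (idfun : measurableTypeR R -> R).
  exact: measurable_id.
rewrite Lfun2P //; apply/Lfun1_integrable/integrableP; split.
  by apply/measurable_EFinP; exact: measurable_funX.
move: fin; rewrite unlock; apply: le_lt_trans.
rewrite le_eqVlt; apply/orP; left; apply/eqP.
by apply: eq_integral => x _ /=; rewrite ger0_norm // sqr_ge0.
Qed.

Lemma Lfun2_coordinate i :
  (idfun : measurableTypeR R -> R) \in Lfun (mui i) 2%:E ->
  coordinate i \in Lfun mu 2%:E.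
Proof.
exact: (Lfun2_preserving mu (mui i) _ (measurable_coordinate i)
  (coordinate_preserving i)).
Qed.

Lemma cov_coordinate i :
  (idfun : measurableTypeR R -> R) \in Lfun (mui i) 2%:E ->
  cov mu (coordinate i) (coordinate i) = cov (mui i) idfun idfun.
Proof.
move=> id2; rewrite /cov.
have pres := Ex_preserving mu (mui i) _ (measurable_coordinate i) (coordinate_preserving i).
by rewrite -(pres _ (Lfun21 _ _ id2)) -(pres _ (Lfun_mul2 _ _ _ id2 id2)).
Qed.

End Marginals.

Theorem corollary1p5 (R : realType) (d : nat)
    (mui : 'I_d -> probability (measurableTypeR R) R)
    (mu : probability 'rV[R]_d R)
    (mu_prod : is_product_measure mu mui)
    (mui_moment2 : forall i,
      ('E_(mui i)[fun x : measurableTypeR R => ((x : R) ^+ 2)%R] < +oo)%E)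
    (mui_var : forall i, (0 < variance (mui i) idfun)%E)
    (f g : 'rV[R]_d -> R)
    (f_L2 : f \in Lfun mu 2%:E) (g_L2 : g \in Lfun mu 2%:E)
    (f_partial : forall i, has_partial i f)
    (g_partial : forall i, has_partial i g)
    (f_partial2 : forall i j, has_partial i (partial j f))
    (g_partial2 : forall i j, has_partial i (partial j g))
    (f_partial_int : forall i, mu.-integrable setT (EFin \o partial i f))
    (g_partial_int : forall i, mu.-integrable setT (EFin \o partial i g))
    (f_partial2_int : forall i j,
      mu.-integrable setT (EFin \o partial i (partial j f)))
    (g_partial2_int : forall i j,
      mu.-integrable setT (EFin \o partial i (partial j g)))
    (fg_sign : forall i j,
      same_constant_sign (partial i (partial j f)) (partial i (partial j g))) :
  (\sum_(i < d) ((fine (variance (mui i) idfun))^-1)%:E *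
      (covariance mu f (coordinate i) * covariance mu g (coordinate i))
    <= covariance mu f g)%E.
Proof.
have id2 i := Lfun2_idfun (mui i) (mui_moment2 i).
have coord2 i := Lfun2_coordinate mui mu mu_prod i (id2 i).
have varE i : variance (mui i) idfun = (cov mu (coordinate i) (coordinate i))%:E.
  by rewrite /variance (cov_coordinate mui mu mu_prod i (id2 i)) covarianceEx.
rewrite covarianceEx //.
rewrite (eq_bigr (fun i => ((cov mu (coordinate i) (coordinate i))^-1 *
  (cov mu f (coordinate i) * cov mu g (coordinate i)))%:E)); last first.
  by move=> i _; rewrite varE !covarianceEx.
rewrite sumEFin lee_fin; apply: (covariance_bound mui mu mu_prod coord2) => // i.
by rewrite -lte_fin -varE.
Qed.
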